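(* Let $G$ be a finite primitive permutation group on a set $\Omega$ and let $p$ be a prime dividing $|\Omega|$. Then one of the following holds: (i) $G$ has a subdegree divisible by $p$; (ii) $G$ is almost simple or affine; (iii) $G\le H\wr K$ acting in product action on $\Omega=\Delta^k$ (with $k\ge 2$) with primitive component $H$, where $H$ is almost simple, $H$ has no subdegree divisible by $p$ (in its action on $\Delta$), and for each $r\le k$, each orbit of $K$ on the set of $r$-subsets of $\{1,\dots,k\}$ has size coprime to $p$.
   Context: A subdegree is the size of an orbit of a point stabiliser. Product action: $\mathrm{Sym}(\Delta)\wr S_k$ acts on $\Delta^k$ with the base group acting coordinatewise and $S_k$ permuting coordinates. If $G\le\mathrm{Sym}(\Delta)\wr S_k$ is primitive in this action, $K\le S_k$ denotes the image of $G$ under the natural map to $S_k$; if $G_1$ is the stabiliser in $G$ of the coordinate $1$ and $\pi_1$ the projection onto the first coordinate factor $\mathrm{Sym}(\Delta)$, the primitive component of $G$ (relative to $\Omega=\Delta^k$) is $H=\pi_1(G_1)\le\mathrm{Sym}(\Delta)$, which is primitive on $\Delta$; up to conjugation $G\le H\wr K$. Affine means a unique minimal normal subgroup that is elementary abelian and regular; almost simple means $T\le G\le\mathrm{Aut}(T)$ for a nonabelian simple $T$. *)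

(* Defs.v *)
From mathcomp Require Import all_boot all_fingroup all_solvable.
Set Implicit Arguments.
Unset Strict Implicit.
Unset Printing Implicit Defensive.
Local Open Scope group_scope.

(* Almost simple: G has a nonabelian simple normal subgroup T with
   C_G(T) = 1, i.e. T <= G <= Aut(T) up to isomorphism (conjugation action). *)
Definition almost_simple (gT : finGroupType) (G : {set gT}) : Prop :=
  exists T : {group gT}, [/\ T <| G, simple T, ~~ abelian T & 'C_G(T) = 1].

Definition affine (Om : finType) (G : {set {perm Om}}) : Prop :=
  exists N : {group {perm Om}},
    [/\ minnormal N G,
        (forall M : {group {perm Om}}, minnormal M G -> M = N),
        (exists q, prime q /\ q.-abelem N),
        [transitive N, on [set: Om] | 'P]
      & forall x : Om, 'C_N[x | 'P] = 1].

Definition has_subdegree_div (Om : finType) (G : {set {perm Om}}) (p : nat) : Prop :=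
  exists x y : Om, (p %| #|orbit 'P 'C_G[x | 'P] y|)%N.

(* Product action of Sym(D) wr S_k on D^k = {ffun 'I_k -> D}, transported to
   Om via the bijection phi : Om -> D^k.  The permutation g of Om is the
   element (h_1,...,h_k) s of the wreath product: it sends the point with
   coordinates f to the point whose (s i)-th coordinate is h_i (f i). *)
Definition wr_elt (Om D : finType) (k : nat) (phi : Om -> {ffun 'I_k -> D})
    (g : {perm Om}) (s : {perm 'I_k}) (h : {ffun 'I_k -> {perm D}}) : bool :=
  [forall x : Om, [forall i : 'I_k, phi (g x) (s i) == h i (phi x i)]].

Definition in_prod_wreath (Om D : finType) (k : nat) (phi : Om -> {ffun 'I_k -> D})
    (G : {set {perm Om}}) : Prop :=
  forall g, g \in G -> exists s h, wr_elt phi g s h.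

Definition top_group (Om D : finType) (k : nat) (phi : Om -> {ffun 'I_k -> D})
    (G : {set {perm Om}}) : {group {perm 'I_k}} :=
  <<[set s : {perm 'I_k} | [exists g in G, exists h : {ffun 'I_k -> {perm D}}, wr_elt phi g s h]]>>%G.

Definition prim_component (Om D : finType) (k : nat) (phi : Om -> {ffun 'I_k -> D})
    (G : {set {perm Om}}) (i : 'I_k) : {group {perm D}} :=
  <<[set h0 : {perm D} | [exists g in G, exists s : {perm 'I_k}, exists h : {ffun 'I_k -> {perm D}},
        [&& s i == i, h i == h0 & wr_elt phi g s h]]]>>%G.

(* Main.v *)
Require Import Defs.
From mathcomp Require Import all_boot all_fingroup all_solvable.
Set Implicit Arguments.
Unset Strict Implicit.
Unset Printing Implicit Defensive.
Local Open Scope group_scope.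

(** If [T] and [C] commute, [T C] is normal in [G] and [C] is transitive, then
    the orbits of the stabiliser of [x] in [T C] on the points [t x] have the
    sizes of the conjugacy classes of [T]. When [T] has trivial centre and order
    divisible by [p], one of these sizes is divisible by [p], since otherwise
    the conjugates of the centraliser of a Sylow [p]-subgroup would cover [T].

    Let [N] be a minimal normal subgroup, nonabelian (else [G] is affine), and
    [T] a minimal normal subgroup of [N]; it is simple and [N = T C], where
    [C] centralises [T] in [N]. If [C] is transitive (the diagonal types), the
    previous remark gives a subdegree. Otherwise, the coordinates of a point are
    its orbits under the conjugates of [C]: two points with the same coordinates
    are related by a [G]-congruence, which is trivial by primitivity, and each
    conjugate of [T] moves one coordinate only, so all coordinates occur.
    This includes the twisted wreath case, so that [T] may be regular on a
    coordinate and no use of the Schreier conjecture is needed. Subdegrees of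
    the component and orbits of the top group on subsets are then read off
    pairs of points that differ in one coordinate, respectively in the
    coordinates of the subset. *)

(** * Class sizes in a group with trivial centre *)

(** At most [#|G : H|] conjugates share the identity, so together they have at most
    [#|G : H| * #|H|.-1 + 1] elements, fewer than [#|G|]. *)
Lemma class_support_proper (gT : finGroupType) (G H : {group gT}) :
  H \proper G -> class_support H G \proper G.
Proof.
move=> ltHG; have sHG := proper_sub ltHG.
rewrite properEcard class_support_subG //=.
have le_cov: #|(class_support H G)^#| <= #|G : H| * #|H|.-1.
  rewrite class_supportD1; apply: leq_trans (leq_of_leqif (leq_card_cover _)) _.
  rewrite (eq_bigr (fun=> #|H|.-1)) => [|_ /imsetP[x _ ->]]; last first.
    by rewrite cardJg [in RHS](cardsD1 1) group1.
  rewrite sum_nat_const leq_mul2r; apply/orP; right.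
  rewrite card_conjugates; apply: dvdn_leq; first exact: indexg_gt0.
  by apply: indexgS; rewrite subsetI sHG /= normD1 normG.
rewrite (cardsD1 1) mem_class_support // add1n.
have iGH: 1 < #|G : H| by rewrite indexg_gt1 proper_subn.
apply: leq_ltn_trans (_ : (#|G : H| * #|H|.-1).+1 < _); first by rewrite ltnS.
rewrite -(Lagrange sHG) [X in _ < X]mulnC -{2}(prednK (cardG_gt0 H)) mulnS.
by rewrite -(add1n (_ * _)) ltn_add2r.
Qed.

Lemma dvdn_class_center1 (gT : finGroupType) (M : {group gT}) p :
  prime p -> p %| #|M| -> 'Z(M) = 1 -> exists2 t, t \in M & p %| #|t ^: M|.
Proof.
move=> p_pr pM Z1; apply/exists_inP; apply: contraT => /exists_inPn noP.
have [P sylP] := Sylow_exists p M.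
have ntP : P :!=: 1.
  by rewrite -rank_gt0 (rank_Sylow sylP) p_rank_gt0 mem_primes p_pr cardG_gt0.
have sPM := pHall_sub sylP.
have ltCM : 'C_M(P) \proper M.
  rewrite properE subsetIl subsetI subxx /=.
  by apply: contra ntP => cMP; rewrite -subG1 -Z1 subsetI sPM centsC.
have /proper_subn/negP[] := class_support_proper ltCM.
apply/subsetP=> t Mt; have := noP t Mt; rewrite -index_cent1 => p'i.
(* Since [p] does not divide the class size of [t], this Sylow subgroup of the centraliser is Sylow
   in [M]; being conjugate to [P], it puts [t] into a conjugate of ['C_M(P)]. *)
have [Q sylQ] := Sylow_exists p 'C_M[t].
have sylQM : p.-Sylow(M) Q.
  rewrite /pHall (subset_trans (pHall_sub sylQ)) ?subsetIl // (pHall_pgroup sylQ).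
  rewrite -(Lagrange_index (subsetIl M 'C[t]) (pHall_sub sylQ)) pnatM p'natE //.
  by rewrite p'i; have /and3P[] := sylQ.
have [m Mm defQ] := Sylow_trans sylP sylQM.
rewrite -[t](conjgKV m) memJ_class_support // inE groupJ ?groupV //=.
rewrite -mem_conjg -centJ -defQ -sub1set centsC.
by rewrite (subset_trans (pHall_sub sylQ)) // cent_set1 subsetIr.
Qed.

(** * Orbits and subdegrees of commuting subgroups *)

Lemma orbit_normal_dvd (aT : finGroupType) (rT : finType)
    (to : {action aT &-> rT}) (M L : {group aT}) x :
  M <| L -> #|orbit to M x| %| #|orbit to L x|.
Proof.
case/andP=> sML nML; rewrite !card_orbit.
have nMC : 'C_L[x | to] \subset 'N(M) by rewrite subIset ?nML.
have -> : 'C_M[x | to] = M :&: 'C_L[x | to] by rewrite setIA (setIidPl sML).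
rewrite indexgI -indexMg -(norm_joinEl nMC).
by apply: indexSg; rewrite ?joing_subl // join_subG subsetIl.
Qed.

Lemma trans_cent_fix (Om : finType) (C : {group {perm Om}}) (u : {perm Om}) x :
  [transitive C, on [set: Om] | 'P] -> u \in 'C(C) -> u x = x -> u = 1.
Proof.
move=> trC /centP cCu ux; apply/permP=> z; rewrite perm1.
have [c Cc ->] := atransP2 trC (in_setT x) (in_setT z).
by rewrite /= apermE -permM -cCu // permM ux.
Qed.

Lemma subdegree_commuting (Om : finType) (G T C : {group {perm Om}}) p :
    prime p -> p %| #|T| -> 'Z(T) = 1 ->
    C \subset 'C(T) -> T <*> C <| G -> [transitive C, on [set: Om] | 'P] ->
  has_subdegree_div G p.
Proof.
move=> p_pr pT ZT cTC nTC trC; have [x _ _] := imsetP trC.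
have [t Tt p_t] := dvdn_class_center1 p_pr pT ZT.
have sTC : T \subset T <*> C := joing_subl _ _.
have sCC : C \subset T <*> C := joing_subr _ _.
have comm u c : u \in T -> c \in C -> u * c = c * u.
  by move=> Tu Cc; rewrite (centP (subsetP cTC _ Cc) _ Tu).
(* An element [u * c] that fixes [x] conjugates [t] to [t ^ u], so it moves [t x] as [u] moves [t]
   in its class. *)
have moveP u c : u \in T -> c \in C -> c (u x) = x -> c (u (t x)) = (t ^ u) x.
  move=> Tu Cc ucx; rewrite -[in RHS]ucx -!permM; congr (fun_of_perm _ x).
  by rewrite -(comm _ c) ?groupJ // [LHS]mulgA [RHS]mulgA -conjgC.
exists x, (t x); apply: dvdn_trans p_t _.
pose S := 'C_(T <*> C)[x | 'P].
have nS : S <| 'C_G[x | 'P].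
  rewrite /S -{1}(setIidPr (normal_sub nTC)) setIAC.
  by apply: normalGI nTC; apply: subsetIl.
apply: dvdn_trans (orbit_normal_dvd 'P (t x) nS).
have -> : orbit 'P S (t x) = (fun u : {perm Om} => u x) @: (t ^: T).
  apply/setP=> y; apply/imsetP/imsetP=> [[g] | [_ /imsetP[u Tu ->] ->]].
    case/setIP; rewrite /= cent_joinEr // => /mulsgP[u c Tu Cc ->] /astab1P.
    rewrite /= !apermE permM => ucx ->; exists (t ^ u); first exact: imset_f.
    by rewrite /= permM moveP.
  have [c Cc] := atransP2 trC (in_setT (u x)) (in_setT x); rewrite /= apermE => xc.
  exists (u * c).
    rewrite inE groupM ?(subsetP sTC u) ?(subsetP sCC c) //=.
    by apply/astab1P; rewrite /= apermE permM -xc.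
  by rewrite /= apermE [RHS]permM moveP.
rewrite [X in _ %| X]card_in_imset // => u v.
move=> /imsetP[a Ta ->] /imsetP[b Tb ->] eqx.
apply/eqP; rewrite eq_mulgV1; apply/eqP; apply: (trans_cent_fix (x := x) trC).
  by rewrite centsC in cTC; rewrite (subsetP cTC) // groupM ?groupV ?groupJ.
by rewrite permM eqx permK.
Qed.

(** * Congruences of a primitive group *)

(** Having equal [A]-orbits after every element of [G] is a [G]-congruence; it is not universal as
    [A] is intransitive, so it is equality. *)
Lemma primitive_inj_orbits (Om : finType) (G A : {group {perm Om}}) x y :
    [primitive G, on [set: Om] | 'P] -> ~~ [transitive A, on [set: Om] | 'P] ->
    (forall g, g \in G -> orbit 'P A (g x) = orbit 'P A (g y)) ->
  x = y.
Proof.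
move=> /andP[_ /existsPn prG] ntrA eq_xy.
pose R x y := [forall g in G, orbit 'P A (g x) == orbit 'P A (g y)].
pose Q := equivalence_partition R [set: Om].
have RP u v :
    reflect (forall g, g \in G -> orbit 'P A (g u) = orbit 'P A (g v)) (R u v).
  by apply: (iffP forall_inP) => E g Gg; apply/eqP; apply: E.
have eqR : {in setT & &, equivalence_rel R}.
  move=> a b c _ _ _; split; first exact/RP.
  by move/RP=> E; apply/RP/RP => F g Gg; rewrite -F ?E.
pose f u := [set v in setT | R u v].
have feq u v : R u v -> f u = f v.
  move=> Ruv; apply/setP=> w; rewrite !inE /=.
  by have [_ ->] := eqR u v w (in_setT u) (in_setT v) (in_setT w).
have := prG Q; rewrite /imprimitivity_system equivalence_partitionP //=.
have -> /= : [acts G, on Q | 'P^*].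
  apply/subsetP=> g Gg; rewrite !inE; apply/subsetP=> _ /imsetP[u _ ->].
  rewrite inE; apply/imsetP; exists (g u) => //; apply/setP=> z.
  rewrite -[z](permKV g) /= (mem_imset _ _ (act_inj 'P g)) !inE /=; move: (g^-1 z) => w.
  apply/RP/RP=> E h Gh; first by rewrite -!permM E ?groupM.
  by have := E (g^-1 * h); rewrite !permM !permK; apply; rewrite groupM ?groupV.
rewrite negb_and -!leqNgt => /orP[cQ|cQ].
  case/negP: ntrA; apply/imsetP; exists x => //; apply/esym/setP=> z; rewrite inE.
  have/card_le1_eqP/(_ _ _ (imset_f f (in_setT z)) (imset_f f (in_setT x))) := cQ.
  move/setP/(_ x); rewrite !inE /= => /esym E.
  have /RP/(_ 1 (group1 G)) : R z x by rewrite E; exact/RP.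
  by rewrite !perm1 => <-; apply: orbit_refl.
have /imset_injP injf : #|Q| == #|[set: Om]|.
  by rewrite eqn_leq leq_imset_card.
by apply: injf => //; apply/feq/RP.
Qed.

Lemma orbit_normJ (Om : finType) (A : {group {perm Om}}) (g : {perm Om}) x y :
  g \in 'N(A) -> orbit 'P A x = orbit 'P A y -> orbit 'P A (g x) = orbit 'P A (g y).
Proof.
move=> nAg /orbit_eqP xy; apply/orbit_eqP.
by rewrite -{1}(normP nAg) (orbit_conjsg 'P A g y x).
Qed.

Lemma orbit_perm_id (Om : finType) (A : {group {perm Om}}) (a : {perm Om}) x :
  a \in A -> orbit 'P A (a x) = orbit 'P A x.
Proof. by move=> Aa; apply/orbit_eqP/(mem_orbit 'P x Aa). Qed.

(** If [M] were intransitive, [x] and [m x] would have equal [M]-orbits after every [g], which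
    normalises [M]; so [m] would fix every [x]. *)
Lemma primitive_norm_trans (Om : finType) (G M : {group {perm Om}}) :
    [primitive G, on [set: Om] | 'P] -> G \subset 'N(M) -> M :!=: 1 ->
  [transitive M, on [set: Om] | 'P].
Proof.
move=> prG nMG; apply: contraR => ntrM; rewrite -subG1.
apply/subsetP=> m Mm; rewrite inE; apply/eqP/permP=> x; rewrite perm1.
apply: (primitive_inj_orbits prG ntrM) => g Gg.
by apply: orbit_normJ; rewrite ?orbit_perm_id // (subsetP nMG).
Qed.

(* [minnormal M G] does not require [M] to lie in [G], so the uniqueness
   of [N] concerns all subgroups normalised by [G]: a second one would be
   a transitive group on which the [q]-group [N] acts without fixed points,
   while [q] divides its order. *)
Lemma primitive_abelian_affine (Om : finType) (G N : {group {perm Om}}) :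
    [primitive G, on [set: Om] | 'P] -> 1 < #|Om| ->
    minnormal N G -> N \subset G -> abelian N ->
  affine G.
Proof.
move=> prG Om_gt1 minN sNG abN; have [/andP[ntN nNG] minNP] := mingroupP minN.
have trN := primitive_norm_trans prG nNG ntN.
have [_ _ /is_abelemP[q q_pr abelN]] :=
  minnormal_solvable minN (subxx N) (abelian_sol abN).
exists N; split=> //; [|by exists q | move=> x]; last first.
  apply/trivgP/subsetP=> n /setIP[Nn /astab1P]; rewrite /= apermE => nx.
  by rewrite inE (trans_cent_fix trN (subsetP abN n Nn) nx).
move=> M minM; have [/andP[ntM nMG] minMP] := mingroupP minM; apply/val_inj=> /=.
have nI : G \subset 'N(M :&: N) by rewrite normsI.
have [I1 | ntI] := eqVneq (M :&: N) 1; last first.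
  have IN : (M :&: N)%G = N :> {set _} by apply: minNP; rewrite ?subsetIr //= ntI.
  by rewrite -IN /=; apply/esym/minMP; rewrite ?subsetIl //= ntI.
have trM := primitive_norm_trans prG nMG ntM.
have qM : q %| #|M|.
  have [x _ _] := imsetP trN.
  have := dvdn_orbit 'P M x; rewrite (atransP trM) ?inE // cardsT; apply: dvdn_trans.
  have := dvdn_orbit 'P N x; rewrite (atransP trN) ?inE // cardsT => OmN.
  have /p_natP[[|n] Om_q] := pnat_dvd OmN (abelem_pgroup abelN).
    by rewrite Om_q in Om_gt1.
  by rewrite Om_q expnS dvdn_mulr.
have CMN : 'C_M(N) = 1.
  apply/trivgP/subsetP=> m /setIP[Mm cNm]; rewrite -I1 inE Mm /=.
  have [x _ _] := imsetP trN.
  have [n Nn] := atransP2 trN (in_setT x) (in_setT (m x)); rewrite /= apermE => mx.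
  suffices /eqP : m * n^-1 = 1 by rewrite -eq_mulgV1 => /eqP->.
  apply: (trans_cent_fix (x := x) trN); last by rewrite permM mx permK.
  by rewrite groupM ?groupV // (subsetP abN).
have actNM : [acts N, on M | 'J] by rewrite astabsJ (subset_trans sNG).
have := pgroup_fix_mod (abelem_pgroup abelN) actNM.
by rewrite afixJ CMN cards1 (eqP qM) modn_small ?prime_gt1.
Qed.

Lemma simple_center1 (gT : finGroupType) (T : {group gT}) :
  simple T -> ~~ abelian T -> 'Z(T) = 1.
Proof.
case/simpleP=> _ /(_ _ (center_normal T))[//|ZT] /negP[].
exact/center_idP.
Qed.

(** * Orbits of image groups and wreath decompositions *)

(** Compares orbits of the component and of the top group with subdegrees: [L] will be the
    stabiliser of a point, [S] that of two points, and [M] the part of [L] that acts through [f]. *)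
Lemma orbit_morphim_dvd (aT rT : finGroupType) (sT : finType)
    (to : {action rT &-> sT}) (D0 L M S : {group aT}) (f : {morphism D0 >-> rT}) z :
    S \subset M -> M \subset L -> M \subset D0 ->
    (forall s, s \in S -> to z (f s) = z) ->
  #|orbit to (f @* M) z| %| #|L : S|.
Proof.
move=> sSM sML sMD fixz; rewrite card_orbit.
have sSC : f @* S \subset 'C_(f @* M)[z | to].
  rewrite subsetI morphimS //=; apply/subsetP=> _ /morphimP[s _ Ss ->].
  exact/astab1P/fixz.
apply: dvdn_trans (indexgS _ sSC) _; apply: dvdn_trans (index_morphim _ _) _.
  by rewrite subIset ?sMD.
exact: indexSg.
Qed.

Lemma wr_elt_uniq (Om D : finType) (k : nat) (phi : Om -> {ffun 'I_k -> D})
    (d d' : D) g s h s' h' :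
    bijective phi -> d != d' -> wr_elt phi g s h -> wr_elt phi g s' h' ->
  s = s' /\ h = h'.
Proof.
move=> [psi _ psiK] ne_d /'forall_'forall_eqP E /'forall_'forall_eqP E'.
have eq_s : s = s'.
  apply/permP=> i; pose j := s'^-1 (s i); rewrite -[s i](permKV s') -/j.
  have [-> // | ne_ij] := eqVneq j i.
  (* If [i] and [j] differ, coordinate [s i] of the image depends only on coordinate [i] and also
     only on coordinate [j], which makes [h i] constant. *)
  have cst a : h i a = h' j d.
    have := E (psi [ffun l => if l == i then a else d]) i.
    rewrite !psiK ffunE eqxx => <-.
    have -> : s i = s' j by rewrite permKV.
    by rewrite E' psiK ffunE (negPf ne_ij).
  by case/eqP: ne_d; apply: (@perm_inj _ (h i)); rewrite !cst.
split=> //; apply/ffunP=> i; apply/permP=> a.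
have := E (psi [ffun l => a]) i; have := E' (psi [ffun l => a]) i.
by rewrite -eq_s psiK ffunE => -> ->.
Qed.

(** * Coordinates from the orbits of the centraliser of a factor *)

Section ProductAction.

Variables (Om : finType) (G N T : {group {perm Om}}) (p : nat).
Hypothesis prG : [primitive G, on [set: Om] | 'P].
Hypothesis nNG : N <| G.
Hypothesis trN : [transitive N, on [set: Om] | 'P].
Hypothesis nTN : T <| N.
Let C := 'C_N(T)%G.
(** The stabiliser of the coordinate that belongs to [T]. *)
Let Y := 'N_G(T)%G.
Hypothesis mulTC : T * C = N.
Hypothesis conjT : forall x, x \in G -> T :^ x = T \/ T :^ x \subset C.
Hypothesis ntrC : ~~ [transitive C, on [set: Om] | 'P].

Let sNG : N \subset G := normal_sub nNG.
Let sTN : T \subset N := normal_sub nTN.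
Let sCN : C \subset N := subsetIl _ _.
Let sYG : Y \subset G := subsetIl _ _.

Let sNY : N \subset Y.
Proof. by rewrite subsetI sNG normal_norm. Qed.

Let sTY : T \subset Y := subset_trans sTN sNY.

Let nCY : Y \subset 'N(C).
Proof.
rewrite normsI ?norms_cent ?subsetIr //.
exact: subset_trans sYG (normal_norm nNG).
Qed.

Let Bl x := orbit 'P C x.

Let Bl_cent c x : c \in C -> Bl (c x) = Bl x.
Proof. exact: orbit_perm_id. Qed.

(** An element of [N] taking [x] to [y] is some [t * c], where [c] keeps every [C]-orbit; an element
    [g] outside [Y] conjugates [t] into [C], so [g (t x)] and [g x] share a [C]-orbit. *)
Let T_moves x y : exists t, [/\ t \in T, Bl (t x) = Bl y
  & forall g, g \in G -> g \notin Y -> Bl (g (t x)) = Bl (g x)].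
Proof.
have [n Nn ->] := atransP2 trN (in_setT x) (in_setT y).
move: Nn; rewrite -mulTC => /mulsgP[t c Tt Cc ->]; exists t; split=> //.
  by rewrite /= apermE permM (Bl_cent _ Cc).
move=> g Gg nYg; rewrite -permM conjgC permM; apply: Bl_cent.
have [nTg | /subsetP->//] := conjT Gg; last by rewrite memJ_conjg.
by case/negP: nYg; rewrite inE Gg; apply/normP.
Qed.

Let Bls : {set {set Om}} := [set Bl x | x in setT].
Definition block := {B : {set Om} | B \in Bls}.

Let mem_Bls x : Bl x \in Bls. Proof. exact: imset_f. Qed.
Let bl x : block := Sub (Bl x) (mem_Bls x).

Let eq_bl x y : (bl x = bl y) <-> (Bl x = Bl y).
Proof. by split=> [/(congr1 val) | E]; last exact: val_inj. Qed.

Let blP (d : block) : exists x, d = bl x.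
Proof. by case: d => B BlB; case/imsetP: (BlB) => x _ E; exists x; apply: val_inj. Qed.

Let bl_surj x y : exists t, [/\ t \in T, bl (t x) = bl y
  & forall g, g \in G -> g \notin Y -> bl (g (t x)) = bl (g x)].
Proof.
have [t [Tt /eq_bl E1 E2]] := T_moves x y; exists t; split=> // g Gg nYg.
exact/eq_bl/E2.
Qed.

Let rho := actperm (subaction (block : subFinType _) 'P^*).

Let Bl_img u x : u \in Y -> ('P^*)%act (Bl x) u = Bl (u x).
Proof.
move=> Yu; apply/setP=> z; rewrite -[z](permKV u) /=; move: (u^-1 z) => w.
rewrite (mem_imset _ _ (act_inj 'P u)).
have nCu : u \in 'N(C) by apply: subsetP nCY _ Yu.
by rewrite -(orbit_conjsg 'P C u x w) (normP nCu).
Qed.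

Let Ydom : Y \subset subact_dom (mem Bls) 'P^*.
Proof.
apply/subsetP=> u Yu; rewrite !inE; apply/subsetP=> B; rewrite !inE.
by case/imsetP=> x _ ->; rewrite Bl_img.
Qed.

Let rhoE u x : u \in Y -> rho u (bl x) = bl (u x).
Proof.
move=> Yu; rewrite /rho actpermE; apply: val_inj; rewrite val_subact.
by rewrite (subsetP Ydom _ Yu) [LHS]Bl_img.
Qed.

Let bl_act u x y : u \in Y -> bl x = bl y -> bl (u x) = bl (u y).
Proof. by move=> Yu E; rewrite -!rhoE ?E. Qed.

Let bl_cent c x : c \in C -> bl (c x) = bl x.
Proof. by move=> Cc; apply/eq_bl/Bl_cent. Qed.

Let bl_neq : exists x y, bl x != bl y.
Proof.
have [x _ _] := imsetP trN; exists x.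
apply/existsP; apply: contraR ntrC => /existsPn E; apply/imsetP; exists x => //.
apply/esym/setP=> y; rewrite inE; have /negPn/eqP/eq_bl : ~~ (bl x != bl y) by [].
by move=> E'; apply/orbit_eqP/esym.
Qed.

Let eq_all_bl x y : (forall g, g \in G -> bl (g x) = bl (g y)) -> x = y.
Proof.
by move=> E; apply: (primitive_inj_orbits prG ntrC) => g Gg; apply/eq_bl/E.
Qed.

Variables (k : nat) (e : 'I_k.+2 -> {perm Om}).
Hypothesis eG : forall i, e i \in G.
Hypothesis e_inj : forall i j, T :^ e i = T :^ e j -> i = j.
Hypothesis e_onto : forall x, x \in G -> exists i, T :^ x = T :^ e i.

(** Coordinate [i] is the orbit of [x] under [C :^ e i], carried back by [(e i)^-1] so that all
    coordinates range over the orbits of [C]. *)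
Definition coords x : {ffun 'I_k.+2 -> block} := [ffun i => bl ((e i)^-1 x)].

Let coords_inj : injective coords.
Proof.
move=> x y /ffunP E; apply: eq_all_bl => g Gg.
(* For this [i], [g] is [(e i)^-1] followed by an element of [Y], so coordinate [i] of a point
   determines the block of its image under [g]. *)
have [i Ti] := e_onto (groupVr Gg).
have Yu : e i * g \in Y.
  by rewrite inE groupM //=; apply/normP; rewrite conjsgM -Ti conjsgKV.
have {}E : bl ((e i)^-1 x) = bl ((e i)^-1 y) by have := E i; rewrite !ffunE.
by have := bl_act Yu E; rewrite !permM !permKV.
Qed.

Let eijY i j : i != j -> e i * (e j)^-1 \notin Y.
Proof.
apply: contra => /setIP[_ /normP nT]; apply/eqP/e_inj.
by rewrite -[in RHS]nT conjsgM conjsgKV.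
Qed.

Let coords_surj f : exists x, coords x = f.
Proof.
have [z zE] : exists z, forall i, f i = bl (z i).
  exact: (fin_all_exists (fun i => blP (f i))).
suffices [x xE] : exists x, forall i, i \in enum 'I_k.+2 -> bl ((e i)^-1 x) = bl (z i).
  by exists x; apply/ffunP=> i; rewrite ffunE zE xE ?mem_enum.
elim: (enum _) (enum_uniq 'I_k.+2) => [_ | i r IHr /andP[ri Ur]].
  by have [x _ _] := imsetP trN; exists x.
have [x xE] := IHr Ur.
have [t [Tt tE1 tE2]] := bl_surj ((e i)^-1 x) (z i).
(* The conjugate of [t] by [e i] sets coordinate [i]; the others stay, because [e i * (e j)^-1] lies
   outside [Y]. *)
exists (e i (t ((e i)^-1 x))) => j; rewrite inE => /orP[/eqP-> | rj].
  by rewrite permK.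
have ne_ij : i != j by apply: contraNneq ri => ->.
have Gij : e i * (e j)^-1 \in G by rewrite groupM ?groupV.
have := tE2 _ Gij (eijY ne_ij); rewrite !permM permKV => ->.
exact: xE.
Qed.

Let coords_bij : bijective coords.
Proof.
have [psi psiE] := fin_all_exists coords_surj.
by exists psi => // x; apply: coords_inj; rewrite psiE.
Qed.

Let is_top g (s : {perm 'I_k.+2}) := [forall i, T :^ e (s i) == T :^ (e i * g)].
(** The action of [g] on the conjugates of [T], read on indices; the default [1] can occur only
    outside [G]. *)
Let top g := odflt 1 [pick s | is_top g s].

Let topP g i : g \in G -> T :^ e (top g i) = T :^ (e i * g).
Proof.
move=> Gg; rewrite /top; case: pickP => [s /forallP/(_ i)/eqP // | no_s].
have [f fE] : exists f, forall i, T :^ (e i * g) = T :^ e (f i).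
  exact: (fin_all_exists (fun j => e_onto (groupM (eG j) Gg))).
have f_inj : injective f.
  move=> j j' E; apply: e_inj; apply: (@conjsg_inj _ g).
  by rewrite -!conjsgM !fE E.
by have /forallP[] := no_s (perm f_inj) => j; rewrite permE fE.
Qed.

Let topM : {in G &, {morph top : g h / g * h}}.
Proof.
move=> g h Gg Gh; apply/permP=> i; apply: e_inj; rewrite permM.
by rewrite !topP ?groupM // mulgA conjsgM [in RHS]conjsgM topP.
Qed.

Let top_wr g : g \in G ->
  wr_elt coords g (top g) [ffun i => rho (e i * g * (e (top g i))^-1)].
Proof.
move=> Gg; apply/'forall_'forall_eqP=> x i; rewrite !ffunE rhoE.
  by rewrite !permM permKV.
rewrite inE; apply/andP; split; first by rewrite !groupM ?groupV.
by apply/normP; rewrite conjsgM -topP // conjsgK.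
Qed.

Let wr_uniq g s h : g \in G -> wr_elt coords g s h ->
  s = top g /\ forall i, h i = rho (e i * g * (e (top g i))^-1).
Proof.
move=> Gg wr; have [x [y ne_xy]] := bl_neq.
have [-> ->] := wr_elt_uniq coords_bij ne_xy wr (top_wr Gg).
by split=> // i; rewrite ffunE.
Qed.

Let rhom := [morphism of rho].
Let topm := Morphism topM.

Let top_groupE : top_group coords G = topm @* G :> {set _}.
Proof.
rewrite /= -[RHS]genGid; congr <<_>>; apply/setP=> s; rewrite inE.
apply/exists_inP/morphimP=> [[g Gg /existsP[h wr]] | [g _ Gg ->]].
  by exists g => //; have [] := wr_uniq Gg wr.
exists g => //; apply/existsP; eexists; exact: top_wr.
Qed.

Let prim_componentE : prim_component coords G ord0 = rhom @* Y :> {set _}.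
Proof.
rewrite /= -[RHS]genGid; congr <<_>>; apply/setP=> u; rewrite inE.
apply/exists_inP/morphimP=> [[g Gg] | [v _ Yv ->]].
  case/existsP=> s /existsP[h /and3P[/eqP s0 /eqP <- wr]].
  have [Es ->] := wr_uniq Gg wr; rewrite -Es s0.
  have Yv : e ord0 * g * (e ord0)^-1 \in Y.
    rewrite inE; apply/andP; split; first by rewrite !groupM ?groupV.
    by apply/normP; rewrite conjsgM -topP // -Es s0 conjsgK.
  by exists (e ord0 * g * (e ord0)^-1) => //; apply: subsetP Ydom _ Yv.
have [Gv /normP nTv] := setIP Yv.
(* Coordinate [ord0] belongs to [T :^ e ord0], so [rho v] is induced there by a conjugate of [v]. *)
have Ge : v ^ e ord0 \in G by rewrite groupJ.
have t0 : top (v ^ e ord0) ord0 = ord0.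
  by apply: e_inj; rewrite topP // -conjgC conjsgM nTv.
exists (v ^ e ord0) => //; apply/existsP; exists (top (v ^ e ord0)).
apply/existsP; exists [ffun i => rho (e i * v ^ e ord0 * (e (top (v ^ e ord0) i))^-1)].
by rewrite top_wr // t0 ffunE t0 -conjgC mulgK !eqxx.
Qed.

(** Frattini argument: [N] is transitive and normalises each conjugate of [T], so [top] is trivial
    on it. *)
Let topm_stab x : topm @* 'C_G[x | 'P] = topm @* G.
Proof.
apply/eqP; rewrite eqEsubset morphimS ?subsetIl //=.
apply/subsetP=> _ /morphimP[g _ Gg ->].
have [n Nn] := atransP2 trN (in_setT (g x)) (in_setT x); rewrite /= apermE => ngx.
have Gn := subsetP sNG n Nn.
have n1 : top n = 1.
  apply/permP=> i; apply: e_inj; rewrite perm1 topP //.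
  have nTi : T :^ e i <| N by rewrite -(normsP (normal_norm nNG) _ (eG i)) normalJ.
  by rewrite conjsgM (normsP (normal_norm nTi)).
have -> : top g = topm (g * n) by rewrite /= topM // n1 mulg1.
have Ggn : g * n \in G := groupM Gg Gn.
apply: mem_morphim; rewrite // inE Ggn /=.
by apply/astab1P; rewrite /= apermE permM -ngx.
Qed.

(** * Orbits of the top group and subdegrees of the component *)

Hypothesis p_pr : prime p.
Hypothesis no_subdeg : ~ has_subdegree_div G p.

Let subdegN x y : ~~ (p %| #|'C_G[x | 'P] : 'C_('C_G[x | 'P])[y | 'P]|).
Proof. by rewrite -card_orbit; apply/negP=> E; apply: no_subdeg; exists x, y. Qed.

Let top_orbits (A : {set 'I_k.+2}) :
  coprime #|orbit ('P^*)%act (top_group coords G) A| p.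
Proof.
have [x1 [y1 ne_xy]] := bl_neq; have [psi _ psiK] := coords_bij.
(* All coordinates of [x] are equal, and [y] differs from it exactly in those from [A]; an element
   that fixes both points must stabilise [A]. *)
pose x := psi [ffun=> bl x1]; pose y := psi [ffun i => bl (if i \in A then y1 else x1)].
rewrite coprime_sym prime_coprime //; apply: contra (subdegN x y).
move/dvdn_trans; apply; rewrite top_groupE -(topm_stab x).
apply: orbit_morphim_dvd; rewrite ?subsetIl // => g /setIP[/setIP[Gg gx] gy].
move/astab1P: gx; move/astab1P: gy; rewrite /= !apermE => gy gx.
have /'forall_'forall_eqP wr := top_wr Gg.
apply/setP=> i; rewrite -[i](permKV (top g)); move: ((top g)^-1 i) => j {i}.
rewrite (mem_imset _ _ (act_inj 'P (top g))).
have := wr x j; have := wr y j; rewrite gx gy !psiK !ffunE => Ey Ex.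
move: (rho _) Ex Ey => r Ex.
case: (j \in A); case: (_ \in A) => // Ey; case/eqP: ne_xy; last by rewrite Ey.
by apply: (@perm_inj _ r); rewrite -Ex.
Qed.



Hypothesis simT : simple T.
Hypothesis nabT : ~~ abelian T.
Hypothesis pT : p %| #|T|.

Let H := prim_component coords G ord0.

Let rhom_cent c : c \in C -> rhom c = 1.
Proof.
move=> Cc; apply/permP=> d; have [x ->] := blP d; rewrite perm1 /= rhoE ?bl_cent //.
exact: subsetP (subset_trans sCN sNY) _ Cc.
Qed.

(** An element of [Y] that fixes the block of [x] takes [x] to a point of its [C]-orbit; an element
    of [C], trivial on blocks, brings it back. *)
Let H_stab x : 'C_H[bl x | 'P] = rhom @* 'C_Y[x | 'P].
Proof.
apply/setP=> h; rewrite inE prim_componentE; apply/andP/morphimP.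
  case=> /morphimP[u Du Yu ->] /astab1P; rewrite /= apermE rhoE // => /eq_bl/orbit_eqP.
  rewrite -orbit_sym => /orbitP[c Cc]; rewrite /= apermE => cux.
  have Yc : c \in Y by apply: subsetP (subset_trans sCN sNY) _ Cc.
  have Yuc : u * c \in Y := groupM Yu Yc.
  exists (u * c); first exact: subsetP Ydom _ Yuc.
    by rewrite inE Yuc; apply/astab1P; rewrite /= apermE permM.
  have Dc := subsetP Ydom _ Yc.
  have -> : rho (u * c) = rhom u * rhom c by apply: morphM.
  by rewrite (rhom_cent Cc) mulg1.
case=> u Du /setIP[Yu /astab1P]; rewrite /= apermE => ux ->.
split; first exact: mem_morphim.
by apply/astab1P; rewrite /= apermE rhoE // ux.
Qed.

Let H_subdeg : ~ has_subdegree_div H p.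
Proof.
case=> d [d']; have [x ->] := blP d; have [y0 ->] := blP d'.
have [<- | ne_xy] := eqVneq (bl x) (bl y0).
  have /orbit1P -> : bl x \in 'Fix_'P('C_H[bl x | 'P]).
    by apply/afixP=> h /setIP[_ /astab1P].
  by rewrite cards1 dvdn1; apply/negP; rewrite neq_ltn prime_gt1 ?orbT.
(* The point [t x] represents the block of [y0], and any element outside [Y] sends it into the block
   of the image of [x]; hence the stabiliser of both points lies in [Y]. *)
have [t [Tt Ey Eg]] := bl_surj x y0; rewrite -Ey in ne_xy *.
set y := t x in Ey Eg ne_xy *.
apply/negP; apply: contra (subdegN x y); move/dvdn_trans; apply.
rewrite H_stab.
have sSY : 'C_('C_G[x | 'P])[y | 'P] \subset Y.
  apply/subsetP=> g /setIP[/setIP[Gg /astab1P gx] /astab1P gy].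
  apply: contraR ne_xy => nYg.
  move: gx gy; rewrite /= !apermE => gx gy.
  have := Eg _ Gg nYg.
  by rewrite gy gx => ->.
apply: orbit_morphim_dvd.
- apply/subsetP=> g Sg; rewrite inE (subsetP sSY _ Sg) /=.
  by have /setIP[/setIP[]] := Sg.
- exact: setSI.
- exact: subset_trans (subsetIl _ _) Ydom.
move=> g Sg; have Yg := subsetP sSY g Sg.
have /setIP[_ /astab1P] := Sg; rewrite /= !apermE => gy.
by rewrite rhoE // gy.
Qed.

Let injT : {in T, forall t, rhom t = 1 -> t = 1}.
Proof.
have nK : ('ker rhom :&: T)%G <| T.
  by rewrite /= setIC; apply: normalGI (subset_trans sTY Ydom) (ker_normal rhom).
have [_ /(_ _ nK)[K1 | KT]] := simpleP _ simT.
  move=> t Tt r1; apply/set1gP; rewrite -K1 inE Tt andbT.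
  by apply/kerP => //; apply: subsetP (subset_trans sTY Ydom) _ Tt.
have [x [y]] := bl_neq.
have [t [Tt <- _]] := bl_surj x y.
have Yt := subsetP sTY t Tt.
have : t \in 'ker rhom by move: Tt; rewrite -{1}KT => /setIP[].
by move/mker=> r1; rewrite -rhoE // [rho t]r1 perm1 eqxx.
Qed.

(* [C_H(T)] is the image of [C_G(T)]: if the latter is intransitive it preserves
   every block, by the same congruence argument as for [C]; if it is transitive,
   [H] has a subdegree divisible by [p]. *)
Let H_almost_simple : almost_simple H.
Proof.
have sTD := subset_trans sTY Ydom.
have isoT : T \isog rhom @* T.
  apply/isogP; exists (restrm_morphism sTD rhom); last by rewrite im_restrm.
  rewrite ker_restrm; apply/subsetP=> t /setIP[Tt /mker r1].
  by rewrite inE (injT Tt r1).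
have nTH : rhom @* T <| H.
  by rewrite prim_componentE morphim_normal // /normal sTY subsetIr.
exists (rhom @* T)%G; split.
- exact: nTH.
- by rewrite -(isog_simple isoT).
- by rewrite -(isog_abelian isoT).
pose Cs := 'C_G(T)%G.
have sCsY : Cs \subset Y by rewrite setIS ?cent_sub.
have eqC : 'C_H(rhom @* T) = rhom @* Cs.
  apply/setP=> h; rewrite inE prim_componentE; apply/andP/morphimP.
    case=> /morphimP[u Du Yu ->] /centP cu; exists u => //.
    have [Gu nTu] := setIP Yu; rewrite inE Gu /=; apply/centP=> t Tt.
    have Dt := subsetP sTD t Tt.
    (* The commutator lies in [T], where [rhom] is injective. *)
    apply/commgP/eqP/injT; last first.
      by rewrite morphR //; apply/eqP/commgP/cu/mem_morphim.
    by rewrite commgEr groupM // memJ_norm ?groupV.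
  case=> u Du Csu ->; have [_ /centP cu] := setIP Csu.
  split; first by apply: mem_morphim => //; apply: subsetP sCsY _ Csu.
  apply/centP=> _ /morphimP[t Dt Tt ->].
  by rewrite /commute -!morphM // cu.
have [trCs | ntrCs] := boolP [transitive Cs, on [set: Om] | 'P].
  case: H_subdeg; apply: (@subdegree_commuting _ H (rhom @* T)%G 'C_H(rhom @* T)%G).
  - by [].
  - by rewrite /= -(card_isog isoT).
  - by apply: simple_center1; rewrite -?(isog_simple isoT) -?(isog_abelian isoT).
  - exact: subsetIr.
  - rewrite normalY //= /normal subsetIl normsI ?normG ?norms_cent //.
    exact: normal_norm nTH.
  have [x _ _] := imsetP trN; apply/imsetP; exists (bl x) => //.
  apply/esym/setP=> d; rewrite [RHS]inE; have [y ->] := blP d.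
  have [c Csc ->] := atransP2 trCs (in_setT x) (in_setT y).
  have Yc := subsetP sCsY c Csc; rewrite /= apermE -rhoE // eqC.
  by apply: mem_orbit; apply: mem_morphim => //; apply: subsetP Ydom _ Yc.
rewrite eqC; apply/trivgP/subsetP=> _ /morphimP[c Dc Csc ->]; rewrite inE.
have Yc := subsetP sCsY c Csc.
apply/eqP/permP=> d; have [x ->] := blP d; rewrite perm1 /= rhoE //.
have lift a b : bl a = bl b -> orbit 'P Cs a = orbit 'P Cs b.
  move/eq_bl/orbit_eqP=> ab; apply/orbit_eqP; apply: subsetP ab.
  by apply: imsetS; apply: setSI.
have [t [Tt Ey Eg]] := bl_surj x (c x); rewrite -Ey.
suffices -> : t x = x by [].
apply: (primitive_inj_orbits prG ntrCs) => g Gg.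
have [Yg | nYg] := boolP (g \in Y); last exact/lift/Eg.
apply: orbit_normJ; last by rewrite (lift _ _ Ey) orbit_perm_id.
by apply: subsetP Yg; rewrite normsI ?norms_cent ?subsetIr // subIset ?normG.
Qed.

Lemma product_action_case :
  exists (D : finType) (k' : nat) (phi : Om -> {ffun 'I_k'.+2 -> D}),
        [/\ bijective phi,
            in_prod_wreath phi G,
            almost_simple (prim_component phi G ord0),
            ~ has_subdegree_div (prim_component phi G ord0) p
          & forall (r : nat), (r <= k'.+2)%N ->
              forall A : {set 'I_k'.+2}, #|A| = r ->
                coprime #|orbit ('P^*)%act (top_group phi G) A| p].
Proof.
exists (block : finType), k, coords; split=> //.
by move=> g Gg; eexists; eexists; exact: top_wr.
Qed.

End ProductAction.

(** * Factors of a minimal normal subgroup *)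

Section MinimalNormal.

Variables (gT : finGroupType) (G N T : {group gT}).
Hypotheses (minN : minnormal N G) (minT : minnormal T N) (sTN : T \subset N).

Let nNG : G \subset 'N(N). Proof. by case/andP: (mingroupp minN). Qed.
Let ntT : T :!=: 1. Proof. by case/andP: (mingroupp minT). Qed.
Let nTN : N \subset 'N(T). Proof. by case/andP: (mingroupp minT). Qed.

Lemma minnormal_normed_eq (K : {group gT}) :
  K :!=: 1 -> K \subset N -> G \subset 'N(K) -> K = N :> {set gT}.
Proof. by case/mingroupP: minN => _ minNP ntK sKN nKG; apply: minNP; rewrite ?ntK. Qed.

(** [N] normalises [T :&: T :^ x], so minimality of [T] makes it [1] or [T]; if it is [1], the two
    normal subgroups commute. *)
Lemma minnormal_conj_cent x :
  x \in G -> T :^ x = T \/ T :^ x \subset 'C_N(T).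
Proof.
move=> Gx; have Nx := normsP nNG x Gx.
have sTxN : T :^ x \subset N by rewrite -Nx conjSg.
have nTxN : N \subset 'N(T :^ x) by rewrite normJ -Nx conjSg.
have [I1 | ntI] := eqVneq (T :&: T :^ x) 1; [right | left].
  rewrite subsetI sTxN (sameP commG1P trivgP) -I1 subsetI.
  rewrite commg_subr commg_subl.
  by rewrite (subset_trans sTxN) ?(subset_trans sTN).
have [_ minTP] := mingroupP minT.
have I_T : (T :&: T :^ x)%G = T :> {set gT}.
  by apply: minTP; rewrite ?subsetIl //= ntI normsI.
by apply/eqP; rewrite eq_sym eqEcard cardJg leqnn andbT -{1}I_T subsetIr.
Qed.

(** The normal closure of [T] in [G] is [N], and every conjugate of [T] is [T] or centralises it. *)
Lemma minnormal_mul_cent : T * 'C_N(T) = N.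
Proof.
have sTCN : T * 'C_N(T) \subset N by rewrite mul_subG ?subsetIl.
apply/eqP; rewrite eqEsubset sTCN.
have defN : <<class_support T G>> = N.
  apply: minnormal_normed_eq.
  - apply: contra ntT; rewrite -!subG1; apply: subset_trans.
    exact: subset_trans (sub_class_support _ _) (subset_gen _).
  - by rewrite gen_subG class_support_sub_norm.
  - by rewrite norms_gen // class_support_norm.
rewrite -{1}defN -cent_joinEr ?subsetIr // gen_subG class_supportEr.
apply/bigcupsP=> x Gx; have [-> | sTxC] := minnormal_conj_cent Gx.
  exact: joing_subl.
exact: subset_trans sTxC (joing_subr _ _).
Qed.

(** A normal subgroup of [T] is also normalised by ['C_N(T)], hence by [N]. *)
Lemma minnormal_simple : simple T.
Proof.
apply/simpleP; split=> // K nKT.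
have [-> | ntK] := eqVneq (K : {set gT}) 1; [by left | right].
have [_ minTP] := mingroupP minT; apply: minTP; last exact: normal_sub nKT.
rewrite ntK /= -minnormal_mul_cent mul_subG ?(normal_norm nKT) //.
by rewrite subIset // orbC cents_norm // centS // normal_sub.
Qed.

(** An abelian [T] would lie in the centre of [N], which would then be all of [N]. *)
Lemma minnormal_factor_nonabelian : ~~ abelian N -> ~~ abelian T.
Proof.
apply: contra => abT; apply/center_idP; apply: minnormal_normed_eq.
- apply: contra ntT; rewrite -!subG1; apply: subset_trans.
  rewrite subsetI sTN -minnormal_mul_cent centsC mul_subG // subsetIr //.
- exact: center_sub.
by apply: char_norm_trans nNG; apply: center_char.
Qed.

(** Otherwise [T] lies in ['O_p^'(N)], which is then all of [N]. *)
Lemma minnormal_factor_prime_dvd p : prime p -> p %| #|N| -> p %| #|T|.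
Proof.
move=> p_pr; apply: contraLR => p'T.
have p'gT : p^'.-group T by rewrite /pgroup p'natE.
rewrite -p'natE // -[_.-nat _]/(p^'.-group N).
have <- : 'O_p^'(N) = N.
  apply: minnormal_normed_eq.
  - apply: contra ntT; rewrite -!subG1; apply: subset_trans.
    by apply: pcore_max; rewrite // /normal sTN.
  - exact: pcore_sub.
  by apply: char_norm_trans nNG; apply: pcore_char.
exact: pcore_pgroup.
Qed.

End MinimalNormal.

(** * Case distinction on a minimal normal subgroup *)

Unset Implicit Arguments.

Theorem theorem3p4 (Om : finType) (G : {group {perm Om}}) (p : nat) :
  [primitive G, on [set: Om] | 'P] ->
  prime p -> (p %| #|Om|)%N ->
  has_subdegree_div G p
  \/ (almost_simple G \/ affine G)
  \/ (exists (D : finType) (k' : nat) (phi : Om -> {ffun 'I_k'.+2 -> D}),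
        [/\ bijective phi,
            in_prod_wreath phi G,
            almost_simple (prim_component phi G ord0),
            ~ has_subdegree_div (prim_component phi G ord0) p
          & forall (r : nat), (r <= k'.+2)%N ->
              forall A : {set 'I_k'.+2}, #|A| = r ->
                coprime #|orbit ('P^*)%act (top_group phi G) A| p]).
Proof.
move=> prG p_pr pOm.
have Om_gt1 : 1 < #|Om|.
  apply: leq_trans (prime_gt1 p_pr) (dvdn_leq _ pOm).
  have /andP[/imsetP[x _ _] _] := prG.
  by apply/card_gt0P; exists x.
have trG : [transitive G, on [set: Om] | 'P] by case/andP: prG.
have ntG : G :!=: 1.
  apply: contraTneq Om_gt1 => G1; have [x _ defOm] := imsetP trG.
  by rewrite -cardsT defOm G1 /orbit imset_set1 cards1.
have [N minN sNG] := minnormal_exists ntG (normG G).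
have [/andP[ntN nNG] _] := mingroupP minN.
have nsNG : N <| G by rewrite /normal sNG.
have trN := primitive_norm_trans prG nNG ntN.
have [abN | nabN] := boolP (abelian N).
  by right; left; right; apply: primitive_abelian_affine minN sNG abN.
have pN : p %| #|N|.
  have [x _ defOm] := imsetP trN.
  by apply: dvdn_trans (dvdn_orbit 'P N x); rewrite -defOm cardsT.
have [T minT sTN] := minnormal_exists ntN (normG N).
have simT := minnormal_simple minN minT sTN.
have nabT := minnormal_factor_nonabelian minN minT sTN nabN.
have pT := minnormal_factor_prime_dvd minN minT sTN p_pr pN.
have mulTC := minnormal_mul_cent minN minT sTN.
have nsTN : T <| N by rewrite /normal sTN; case/andP: (mingroupp minT).
have ZT := simple_center1 simT nabT.
have [trC | ntrC] := boolP [transitive 'C_N(T)%G, on [set: Om] | 'P].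
  left; apply: (subdegree_commuting p_pr pT ZT _ _ trC); first exact: subsetIr.
  by rewrite /= cent_joinEr ?subsetIr // mulTC.
have [TN | neTN] := eqVneq (T : {set _}) N.
  have [C1 | ntC] := eqVneq 'C_G(N) 1; [right; left; left | left].
    by rewrite TN in simT nabT; exists N.
  have nC : G \subset 'N('C_G(N)) by rewrite normsI ?normG ?norms_cent.
  have trC := @primitive_norm_trans _ G 'C_G(N)%G prG nC ntC.
  rewrite TN in ZT; apply: (subdegree_commuting p_pr pN ZT _ _ trC); first exact: subsetIr.
  by rewrite normalY // /normal subsetIl.
have [subdeg | no_subdeg] := boolP [exists x, exists y, p %| #|orbit 'P 'C_G[x | 'P] y|].
  by left; have /existsP[x /existsP[y]] := subdeg; exists x, y.
right; right.
pose S := T :^: G.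
(* If [T] were its only conjugate, [G] would normalise it and it would equal [N]. *)
have : 1 < #|S|.
  rewrite ltnNge; apply: contra neTN => S1; apply/eqP.
  apply: (minnormal_normed_eq minN) => //; first by case/simpleP: simT.
  apply/normsP=> g Gg; rewrite -[RHS]conjsg1.
  by apply: (card_le1_eqP S1); apply: imset_f.
case Sk : #|S| => [|[|k]] // _.
have conj_val i : exists g, g \in G /\ T :^ g = enum_val (cast_ord (esym Sk) i).
  by have /imsetP[g Gg E] := enum_valP (cast_ord (esym Sk) i); exists g.
have [e eP] := fin_all_exists conj_val.
apply: (@product_action_case _ G N T p prG nsNG trN nsTN mulTC _ ntrC k e) => //.
- exact: minnormal_conj_cent.
- by move=> i; case: (eP i).
- move=> i j; rewrite (eP i).2 (eP j).2.
  by move/enum_val_inj/cast_ord_inj.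
- move=> x Gx; have Sx : T :^ x \in S by apply: imset_f.
  exists (cast_ord Sk (enum_rank_in Sx (T :^ x))).
  by rewrite (eP _).2 cast_ordK enum_rankK_in.
by case=> x [y p_xy]; case/negP: no_subdeg; apply/existsP; exists x; apply/existsP; exists y.
Qed.
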